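(* Let $(X,f)$ be a quasi-continuous dynamical system whose phase space $X$ is perfect and Hausdorff. Assume in addition that $X$ is a Baire space with a countable $\pi$-base $\mathscr P=\{P_n:n\in\mathbb N\}$. Then the properties $\mathrm{TT}$, $\mathrm{TT}_+$, $\mathrm{TT}_{++}$, $\mathrm{DO}$, $\mathrm{DO}_+$ and $\mathrm{DO}_{++}$ of $(X,f)$ are equivalent. Furthermore, each of these properties is equivalent to each of the following: (1) $\mathrm{Trans}_f$ contains a dense $G_\delta$-set of $X$. (2) The set $\{x\in X:\omega f(x)=X\}$ contains a dense $G_\delta$-set of $X$.
   Context: $\mathbb N$ denotes the set of nonnegative integers. A dynamical system is a pair $(X,f)$ where $X$ is a topological space (the phase space, with at least two points) and $f:X\to X$ is a map, not necessarily continuous. A map $g:X\to Y$ between topological spaces is quasi-continuous if for every $x_0\in X$, every open neighbourhood $W$ of $g(x_0)$ and every open neighbourhood $U$ of $x_0$, there is a nonempty open set $V\subseteq U$ with $g(V)\subseteq W$. The system $(X,f)$ is quasi-continuous if $f^n$ is quasi-continuous for every $n\in\mathbb N$. A space is perfect if it has no isolated points. A $\pi$-base for $X$ is a family $\mathscr P$ of nonempty open subsets of $X$ such that every nonempty open $U\subseteq X$ contains some $P\in\mathscr P$. For $A,B\subseteq X$, $N(A,B)=\{n\in\mathbb Z: f^n(A)\cap B\neq\emptyset\}$, where for $n<0$, $f^{n}(A)$ means the preimage $(f^{-n})^{-1}(A)$; and $N_+(A,B)=N(A,B)\cap\mathbb N$. TT: for every pair of nonempty open $U,V\subseteq X$,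 $N(U,V)\neq\emptyset$. TT$_+$: for every pair of nonempty open $U,V\subseteq X$, $N_+(U,V)\ne\emptyset$. TT$_{++}$: for every pair of nonempty open $U,V\subseteq X$, $N_+(U,V)$ is infinite. $\mathrm{Orb}_f(x)=\{f^n(x):n\in\mathbb N\}$ and $\omega f(x)=\bigcap_{k\in\mathbb N}\overline{\{f^n(x):n\ge k\}}$. $\mathrm{Trans}_f$ is the set of points $x\in X$ with $\mathrm{Orb}_f(x)$ dense in $X$. An orbit sequence is either a bi-infinite sequence $\langle x_k:k\in\mathbb Z\rangle$ with $f(x_k)=x_{k+1}$ for all $k$, or a sequence $\langle x_k:k\ge n\rangle$ with $n\in\mathbb N$, $f(x_k)=x_{k+1}$ for all $k\ge n$ and $f^{-1}(x_n)=\emptyset$. DO: there is an orbit sequence (of either kind) whose set of elements is dense in $X$. DO$_+$: there is $x\in X$ with $\mathrm{Orb}_f(x)$ dense in $X$. DO$_{++}$: there is $x\in X$ with $\omega f(x)=X$. *)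

(* Defs.v *)
From HB Require Import structures.
From mathcomp Require Import all_boot all_order all_algebra.
From mathcomp Require Import boolp classical_sets functions cardinality.
From mathcomp Require Import topology borel_hierarchy.

Set Implicit Arguments.
Unset Strict Implicit.
Unset Printing Implicit Defensive.

Local Open Scope classical_set_scope.

Definition quasi_continuous (X Y : topologicalType) (g : X -> Y) : Prop :=
  forall (x0 : X) (W : set Y) (U : set X),
    open W -> W (g x0) -> open U -> U x0 ->
    exists V : set X, [/\ open V, V !=set0, V `<=` U & g @` V `<=` W].

Definition quasi_continuous_system (X : topologicalType) (f : X -> X) : Prop :=
  forall n : nat, quasi_continuous (iter n f).

(* [perfect_set] of the library is about closed subsets and limit points; here
   the whole space is required to have no isolated point. *)
Definition perfect_space (X : topologicalType) : Prop :=
  forall x : X, ~ isolated [set: X] x.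

Definition baire_space (X : topologicalType) : Prop :=
  forall F : nat -> set X,
    (forall i, open (F i) /\ dense (F i)) -> dense (\bigcap_i F i).

Definition pi_base (X : topologicalType) (P : set (set X)) : Prop :=
  (forall A : set X, P A -> open A /\ A !=set0) /\
  (forall U : set X, open U -> U !=set0 -> exists2 A : set X, P A & A `<=` U).

(* [Negz k] is the integer - k.+1 *)
Definition iter_image (X : Type) (f : X -> X) (n : int) (A : set X) : set X :=
  match n with
  | Posz k => iter k f @` A
  | Negz k => iter k.+1 f @^-1` A
  end.

Definition hitting_set (X : Type) (f : X -> X) (A B : set X) : set int :=
  [set n | iter_image f n A `&` B !=set0].

(* N(A, B) `&` nat, as a set of natural numbers *)
Definition hitting_set_nat (X : Type) (f : X -> X) (A B : set X) : set nat :=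
  Posz @^-1` hitting_set f A B.

Definition orb (X : Type) (f : X -> X) (x : X) : set X :=
  [set iter n f x | n in [set: nat]].

Definition omega_limit (X : topologicalType) (f : X -> X) (x : X) : set X :=
  \bigcap_(k in [set: nat]) closure [set iter n f x | n in [set n | (k <= n)%N]].

Definition transitive_points (X : topologicalType) (f : X -> X) : set X :=
  [set x | dense (orb f x)].

Definition bi_orbit_seq (X : Type) (f : X -> X) (x : int -> X) : Prop :=
  forall k : int, f (x k) = x (k + 1)%R.

(* The sequence is x n, x n.+1, ...; the values of x below n are irrelevant. *)
Definition orbit_seq_from (X : Type) (f : X -> X) (n : nat) (x : nat -> X) : Prop :=
  (forall k : nat, (n <= k)%N -> f (x k) = x k.+1) /\ f @^-1` [set x n] = set0.

Section TransitivityProperties.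
Variables (X : topologicalType) (f : X -> X).

Definition TT : Prop := forall U V : set X,
  open U -> U !=set0 -> open V -> V !=set0 -> hitting_set f U V !=set0.

Definition TTp : Prop := forall U V : set X,
  open U -> U !=set0 -> open V -> V !=set0 -> hitting_set_nat f U V !=set0.

Definition TTpp : Prop := forall U V : set X,
  open U -> U !=set0 -> open V -> V !=set0 ->
  infinite_set (hitting_set_nat f U V).

Definition DO : Prop :=
  (exists2 x : int -> X, bi_orbit_seq f x & dense (range x)) \/
  (exists n : nat, exists2 x : nat -> X,
     orbit_seq_from f n x & dense [set x k | k in [set k | (n <= k)%N]]).

Definition DOp : Prop := exists x : X, dense (orb f x).

Definition DOpp : Prop := exists x : X, omega_limit f x = [set: X].

End TransitivityProperties.

Definition contains_dense_Gdelta (X : topologicalType) (A : set X) : Prop :=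
  exists G : set X, [/\ Gdelta G, dense G & G `<=` A].

(* Main.v *)
Require Import Defs.
From HB Require Import structures.
From mathcomp Require Import all_boot all_order all_algebra.
From mathcomp Require Import boolp classical_sets functions cardinality.
From mathcomp Require Import topology borel_hierarchy.

Set Implicit Arguments.
Unset Strict Implicit.
Unset Printing Implicit Defensive.

Import Order.TTheory GRing.Theory Num.Theory.

Local Open Scope classical_set_scope.

(** For nonempty open [U] and [V], property [TT] says that some [n >= 0] moves
    a point of [U] into [V], or a point of [V] into [U].  The whole theorem
    rests on removing the second alternative.

    Quasi-continuity of the iterates supplies a refinement step
    ([quasi_continuous_refine]): if [f ^ n] moves some point of [U] into [V],
    it moves a whole nonempty open subset of [U] into [V].  In a perfect
    Hausdorff space every nonempty open set contains two disjoint nonempty open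
    sets; [TT] applied to these yields a positive return time, in whichever
    direction it works.  Refining and repeating gives arbitrarily late return
    times to every nonempty open set ([TT_late_return]).  If now [V] reaches
    [U] after [n] steps, shrink [V] to an open [V'] with [f ^ n (V')]
    inside [U]; if a point [v] of [V'] returns to [V'] at a time [m >= n + k],
    then the point [f ^ n (v)] of [U] reaches [V] after [m - n >= k] steps.  So
    [TT] gives [TTpp] ([TT_late_hitting]).

    Under [TTpp], for [W] nonempty and open, the interiors of the preimages of
    [W] under [f ^ n] for [n >= k] have a dense union, again by refinement.
    The Baire property and the countable pi-base turn this into a dense
    [G_delta] of points whose omega-limit set is the whole space
    ([TTpp_Gdelta_omega_limit]).  Such points have dense orbits, so the
    corresponding statement on [transitive_points], [DOpp] and [DOp] follow.

    The return to [TT] goes through orbits: a dense forward orbit extends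
    backwards, either for ever or until a point without preimage, to a dense
    orbit sequence ([DOp_DO]); and in an orbit sequence any two terms are
    related by a nonnegative iterate, one way or the other, so that density
    gives [TT] ([DO_TT]). *)

(** * Hitting times *)

Lemma infinite_set_natP (A : set nat) :
  infinite_set A <-> forall k, exists2 n, (k <= n)%N & A n.
Proof.
split=> [Ainf k|Aunb /finite_seqP[s As]].
  apply: contrapT => noA; apply: Ainf.
  apply: sub_finite_set (finite_II k) => n An /=.
  by rewrite ltnNge; apply/negP => kn; apply: noA; exists n.
have [n + An] := Aunb (\max_(i <- s) i).+1.
have : n \in s by move: An; rewrite As.
by move=> ns; rewrite ltnNge leq_bigmax_seq.
Qed.

Lemma hitting_set_natP (X : Type) (f : X -> X) (U V : set X) (n : nat) :
  hitting_set_nat f U V n <-> exists2 x, U x & V (iter n f x).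
Proof.
split=> [[_ [[x Ux <-] Vx]]|[x Ux Vx]]; first by exists x.
by exists (iter n f x); split=> //; exists x.
Qed.

(** Negative hitting times of [U] and [V] are, up to sign, the positive hitting
    times of [V] and [U]. *)
Lemma TTP (X : topologicalType) (f : X -> X) :
  TT f <-> forall U V : set X, open U -> U !=set0 -> open V -> V !=set0 ->
    hitting_set_nat f U V !=set0 \/ hitting_set_nat f V U !=set0.
Proof.
split=> tt U V oU U0 oV V0.
  have [[n|n] nUV] := tt _ _ oU U0 oV V0; first by left; exists n.
  right; exists n.+1; apply/hitting_set_natP.
  by case: nUV => y [Uy Vy]; exists y.
have [[n nUV]|[n /hitting_set_natP[x Vx Ux]]] := tt _ _ oU U0 oV V0.
  by exists (Posz n).
case: n Ux => [|n] Ux; last by exists (Negz n), x.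
by exists (Posz 0), x; split=> //; exists x.
Qed.

(** * From topological transitivity to arbitrarily late hitting times *)

Lemma quasi_continuous_refine (X : topologicalType) (f : X -> X)
    (U V : set X) (n : nat) :
  quasi_continuous_system f -> open U -> open V -> hitting_set_nat f U V n ->
  exists U', [/\ open U', U' !=set0, U' `<=` U & U' `<=` iter n f @^-1` V].
Proof.
move=> qc oU oV /hitting_set_natP[x Ux Vx].
have [U' [oU' U'0 U'U fU'V]] := qc n x V U oV Vx oU Ux.
by exists U'; split=> // y U'y; apply: fU'V; exists y.
Qed.

Lemma perfect_hausdorff_split (X : topologicalType) (U : set X) :
  perfect_space X -> hausdorff_space X -> open U -> U !=set0 ->
  exists A B : set X, [/\ open A, A !=set0, A `<=` U,
    [/\ open B, B !=set0 & B `<=` U] & A `&` B = set0].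
Proof.
move=> perf haus oU [x Ux].
have [y Uy yx] : exists2 y, U y & y <> x.
  apply: contrapT => noy; apply: (perf x); split; first by rewrite inE.
  exists U; first exact: open_nbhs_nbhs.
  rewrite setIT; apply/seteqP; split=> [y Uy|_ ->//].
  by apply: contrapT => yx; apply: noy; exists y.
move: haus; rewrite open_hausdorff => /(_ x y).
case=> [|[A B]]; first by apply/eqP => xy; apply: yx.
rewrite /= !inE => -[Ax By] [oA oB AB0].
exists (A `&` U), (B `&` U); split.
- exact: openI.
- by exists x.
- exact: subIsetr.
- by split; [exact: openI | exists y | exact: subIsetr].
- by rewrite setIACA AB0 set0I.
Qed.

(** Disjointness of the two pieces of [U] rules out the time [0]. *)
Lemma TT_return (X : topologicalType) (f : X -> X) (U : set X) :
  perfect_space X -> hausdorff_space X -> TT f -> open U -> U !=set0 ->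
  exists2 n, (0 < n)%N & hitting_set_nat f U U n.
Proof.
move=> perf haus /TTP tt oU U0.
have [A [B [oA A0 AU [oB B0 BU] AB0]]] :=
  perfect_hausdorff_split perf haus oU U0.
wlog [n /hitting_set_natP[x Ax Bx]] : A B oA A0 AU oB B0 BU AB0 /
    hitting_set_nat f A B !=set0.
  move=> wl; have [nAB|nBA] := tt A B oA A0 oB B0; first exact: (wl A B).
  by apply: (wl B A) => //; rewrite setIC.
exists n; last by apply/hitting_set_natP; exists x; [exact: AU|exact: BU].
case: n Bx => // Bx.
by have : (A `&` B) x by []; rewrite AB0.
Qed.

Lemma TT_late_return (X : topologicalType) (f : X -> X) (k : nat) :
  quasi_continuous_system f -> perfect_space X -> hausdorff_space X -> TT f ->
  forall U : set X, open U -> U !=set0 ->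
  exists2 n, (k <= n)%N & hitting_set_nat f U U n.
Proof.
move=> qc perf haus tt; elim: k => [|k IHk] U oU U0.
  by have [n _ nU] := TT_return perf haus tt oU U0; exists n.
have [m m0 mU] := TT_return perf haus tt oU U0.
have [U' [oU' U'0 U'U mU'U]] := quasi_continuous_refine qc oU oU mU.
have [n kn /hitting_set_natP[x U'x U'nx]] := IHk U' oU' U'0.
exists (m + n)%N; first by rewrite -addn1 addnC leq_add.
apply/hitting_set_natP; exists x; first exact: U'U.
by rewrite iterD; exact: mU'U.
Qed.

Lemma TT_late_hitting (X : topologicalType) (f : X -> X) (k : nat)
    (U V : set X) :
  quasi_continuous_system f -> perfect_space X -> hausdorff_space X -> TT f ->
  open U -> U !=set0 -> open V -> V !=set0 ->
  exists2 n, (k <= n)%N & hitting_set_nat f U V n.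
Proof.
move=> qc perf haus tt oU U0 oV V0.
have [[n nUV]|[n nVU]] := (TTP f).1 tt U V oU U0 oV V0.
  have [U' [oU' U'0 U'U nU'V]] := quasi_continuous_refine qc oU oV nUV.
  have [m km /hitting_set_natP[x U'x U'mx]] :=
    TT_late_return k qc perf haus tt oU' U'0.
  exists (n + m)%N; first exact: leq_trans km (leq_addl n m).
  apply/hitting_set_natP; exists x; first exact: U'U.
  by rewrite iterD; exact: nU'V.
have [V' [oV' V'0 V'V nV'U]] := quasi_continuous_refine qc oV oU nVU.
have [m nkm /hitting_set_natP[x V'x V'mx]] :=
  TT_late_return (n + k) qc perf haus tt oV' V'0.
have nm : (n <= m)%N := leq_trans (leq_addr k n) nkm.
exists (m - n)%N; first by rewrite leq_subRL.
apply/hitting_set_natP; exists (iter n f x); first exact: nV'U.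
by rewrite -iterD subnK //; exact: V'V.
Qed.

Lemma TT_TTpp (X : topologicalType) (f : X -> X) :
  quasi_continuous_system f -> perfect_space X -> hausdorff_space X ->
  TT f -> TTpp f.
Proof.
move=> qc perf haus tt U V oU U0 oV V0.
by apply/infinite_set_natP => k; exact: TT_late_hitting.
Qed.

Lemma TTpp_TTp (X : topologicalType) (f : X -> X) : TTpp f -> TTp f.
Proof. by move=> tt U V oU U0 oV V0; apply: infinite_setN0; exact: tt. Qed.

Lemma TTp_TT (X : topologicalType) (f : X -> X) : TTp f -> TT f.
Proof. by move=> tt; apply/TTP => U V oU U0 oV V0; left; exact: tt. Qed.

(** * Generic points *)

(** Only the interiors of the preimages are taken, because the preimage of an
    open set under a quasi-continuous map need not be open; the interior of such
    a preimage is still dense in it. *)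
Definition late_visits (X : topologicalType) (f : X -> X) (W : set X)
    (k : nat) : set X :=
  \bigcup_(n in [set n | (k <= n)%N]) (iter n f @^-1` W)^°.

Lemma open_late_visits (X : topologicalType) (f : X -> X) (W : set X)
    (k : nat) :
  open (late_visits f W k).
Proof. by apply: bigcup_open => n _; exact: open_interior. Qed.

Lemma late_visitsP (X : topologicalType) (f : X -> X) (W : set X) (k : nat)
    (x : X) :
  late_visits f W k x -> exists2 n, (k <= n)%N & W (iter n f x).
Proof. by case=> n kn /interior_subset Wx; exists n. Qed.

Lemma dense_late_visits (X : topologicalType) (f : X -> X) (W : set X)
    (k : nat) :
  quasi_continuous_system f -> TTpp f -> open W -> W !=set0 ->
  dense (late_visits f W k).
Proof.
move=> qc tt oW W0 U U0 oU.
have [n kn nUW] := (infinite_set_natP _).1 (tt U W oU U0 oW W0) k.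
have [V [oV [x Vx] VU nVW]] := quasi_continuous_refine qc oU oW nUW.
exists x; split; first exact: VU.
exists n => //; rewrite /interior; apply: filterS nVW _.
exact: open_nbhs_nbhs.
Qed.

Lemma omega_limitT (X : topologicalType) (f : X -> X) (x : X) :
  omega_limit f x = [set: X] <->
  forall (W : set X) k, open W -> W !=set0 ->
    exists2 n, (k <= n)%N & W (iter n f x).
Proof.
split=> [om W k oW [w Ww]|late].
  have : omega_limit f x w by rewrite om.
  move=> /(_ k I W (open_nbhs_nbhs (conj oW Ww))).
  by move=> [_ [[n kn <-] Wn]]; exists n.
apply/seteqP; split=> // y _ k _ B By.
have [|n kn Bn] := late (B^°) k (open_interior B); first by exists y.
exists (iter n f x); split; first by exists n.
exact: interior_subset.
Qed.

(** The [G_delta] set must treat every pair of a pi-base element and a starting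
    time, hence the enumeration of [nat * nat]. *)
Lemma TTpp_Gdelta_omega_limit (X : topologicalType) (f : X -> X)
    (P : nat -> set X) :
  quasi_continuous_system f -> baire_space X -> pi_base (range P) -> TTpp f ->
  contains_dense_Gdelta [set x : X | omega_limit f x = [set: X]].
Proof.
move=> qc baire [Popen Psub] tt.
(* Numbers that encode no pair are sent to the irrelevant pair (0, 0). *)
pose pair_of (i : nat) : nat * nat := odflt (0%N, 0%N) (unpickle i).
pose F (i : nat) := late_visits f (P (pair_of i).1) (pair_of i).2.
exists (\bigcap_i F i); split.
- by exists F => // i; exact: open_late_visits.
- apply: baire => i; split; first exact: open_late_visits.
  have [oP P0] : open (P (pair_of i).1) /\ P (pair_of i).1 !=set0.
    by apply: Popen; exists (pair_of i).1.
  exact: dense_late_visits.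
- move=> x Fx; apply/omega_limitT => W k oW W0.
  have [_ [j _ <-] PW] := Psub W oW W0.
  have := Fx (pickle (j, k)) I.
  rewrite /F /pair_of pickleK /= => /late_visitsP[n kn Pn].
  by exists n => //; exact: PW.
Qed.

Lemma omega_limitT_dense_orb (X : topologicalType) (f : X -> X) :
  [set x : X | omega_limit f x = [set: X]] `<=` transitive_points f.
Proof.
move=> x /omega_limitT om W W0 oW.
have [n _ Wn] := om W 0%N oW W0.
by exists (iter n f x); split=> //; exists n.
Qed.

Lemma contains_dense_GdeltaS (X : topologicalType) (A B : set X) :
  A `<=` B -> contains_dense_Gdelta A -> contains_dense_Gdelta B.
Proof. by move=> AB [G [GG dG GA]]; exists G; split=> // x /GA/AB. Qed.

Lemma contains_dense_Gdelta_neq0 (X : topologicalType) (A : set X) (x0 : X) :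
  contains_dense_Gdelta A -> A !=set0.
Proof.
case=> G [_ dG GA].
have [|x [_ Gx]] := dG setT _ openT; first by exists x0.
by exists x; exact: GA.
Qed.

(** * Dense orbit sequences *)

Lemma bi_orbit_seq_exists (X : Type) (f : X -> X) (x : X) :
  (forall k y, iter k f y = x -> exists z, f z = y) ->
  exists2 s : int -> X, bi_orbit_seq f s & forall n : nat, s n = iter n f x.
Proof.
move=> pre.
have /choice[g gP] : forall y, exists z,
    (exists k, iter k f y = x) -> f z = y.
  move=> y; have [[k ky]|nk] := EM (exists k, iter k f y = x).
    by have [z zy] := pre k y ky; exists z.
  by exists x => /nk.
have gx k : iter k f (iter k g x) = x.
  elim: k => // k IHk.
  by rewrite iterSr iterS gP //; exists k.
pose s (n : int) := match n with
  | Posz k => iter k f x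
  | Negz k => iter k.+1 g x
  end.
exists s => // -[k|k].
  by rewrite -PoszD addn1.
have -> : (Negz k + 1)%R = (- (Posz k))%R.
  by rewrite NegzE -addn1 PoszD opprD addrNK.
rewrite /= gP; last by exists k.
by case: k => //= k; rewrite -NegzE.
Qed.

Lemma DOp_DO (X : topologicalType) (f : X -> X) : DOp f -> DO f.
Proof.
case=> x dx.
have [[k [y ky noy]]|pre] :=
    EM (exists k, exists2 y, iter k f y = x & forall z, f z <> y).
  right; exists 0%N, (fun n => iter n f y).
    by split=> //; apply/seteqP; split=> // z /=; exact: noy.
  move=> O O0 oO; have [z [Oz [n _ xz]]] := dx O O0 oO.
  exists z; split=> //.
  by exists (n + k)%N => //; rewrite iterD ky.
have [s sP sx] : exists2 s : int -> X, bi_orbit_seq f s &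
    forall n : nat, s n = iter n f x.
  apply: bi_orbit_seq_exists => k y ky; apply: contrapT => noz; apply: pre.
  by exists k, y => // z zy; apply: noz; exists z.
left; exists s => // O O0 oO; have [z [Oz [n _ xz]]] := dx O O0 oO.
by exists z; split=> //; exists (Posz n) => //; rewrite sx.
Qed.

(** The set of terms of an orbit sequence, of either kind, satisfies these
    hypotheses: of two terms the later one is an iterate of the earlier. *)
Lemma dense_comparable_TT (X : topologicalType) (f : X -> X) (D : set X) :
  dense D ->
  (forall x y, D x -> D y -> exists n, iter n f x = y \/ iter n f y = x) ->
  TT f.
Proof.
move=> dD cmp; apply/TTP => U V oU U0 oV V0.
have [x [Ux Dx]] := dD U U0 oU.
have [y [Vy Dy]] := dD V V0 oV.
have [n [xy|yx]] := cmp x y Dx Dy; [left|right]; exists n;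
  apply/hitting_set_natP.
- by exists x; rewrite ?xy.
- by exists y; rewrite ?yx.
Qed.

Lemma bi_orbit_seq_iter (X : Type) (f : X -> X) (s : int -> X) (k : int)
    (n : nat) :
  bi_orbit_seq f s -> iter n f (s k) = s (k + Posz n)%R.
Proof.
move=> sP; elim: n => [|n IHn]; first by rewrite addr0.
by rewrite iterS IHn sP -addrA -PoszD addn1.
Qed.

Lemma orbit_seq_from_iter (X : Type) (f : X -> X) (m : nat) (s : nat -> X)
    (k n : nat) :
  orbit_seq_from f m s -> (m <= k)%N -> iter n f (s k) = s (k + n)%N.
Proof.
move=> [sP _] mk; elim: n => [|n IHn]; first by rewrite addn0.
by rewrite iterS IHn addnS sP // (leq_trans mk) // leq_addr.
Qed.

Lemma DO_TT (X : topologicalType) (f : X -> X) : DO f -> TT f.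
Proof.
case=> [[s sP ds]|[m [s sP ds]]]; apply: (dense_comparable_TT ds).
  move=> _ _ [k _ <-] [l _ <-].
  exists (absz (l - k)%R); rewrite !bi_orbit_seq_iter //.
  have [kl|/ltW lk] := leP k l; [left|right].
    by rewrite gez0_abs ?subr_ge0 // subrKC.
  by rewrite distnC gez0_abs ?subr_ge0 // subrKC.
move=> _ _ [k mk <-] [l ml <-].
have [kl|/ltnW lk] := leqP k l.
  by exists (l - k)%N; left; rewrite (orbit_seq_from_iter _ sP) // subnKC.
by exists (k - l)%N; right; rewrite (orbit_seq_from_iter _ sP) // subnKC.
Qed.

(** * The equivalence *)

Theorem corollary4p5 (X : topologicalType) (f : X -> X) (P : nat -> set X)
    (X_two_points : exists x y : X, x <> y)
    (f_quasi_continuous : quasi_continuous_system f)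
    (X_perfect : perfect_space X)
    (X_hausdorff : hausdorff_space X)
    (X_baire : baire_space X)
    (P_pi_base : pi_base (range P)) :
  [<-> TT f; TTp f; TTpp f; DO f; DOp f; DOpp f;
       contains_dense_Gdelta (transitive_points f);
       contains_dense_Gdelta [set x : X | omega_limit f x = [set: X]]].
Proof.
have [x0 _] := X_two_points.
have TT_pp : TT f -> TTpp f by exact: TT_TTpp.
have TT_Gomega : TT f ->
    contains_dense_Gdelta [set x : X | omega_limit f x = [set: X]].
  by move=> /TT_pp; exact: (TTpp_Gdelta_omega_limit _ _ P_pi_base).
have Gomega_DOpp :
    contains_dense_Gdelta [set x : X | omega_limit f x = [set: X]] -> DOpp f.
  exact: contains_dense_Gdelta_neq0.
have DOpp_DOp : DOpp f -> DOp f.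
  by case=> x xom; exists x; exact: omega_limitT_dense_orb.
have DOp_TT : DOp f -> TT f by move=> /DOp_DO/DO_TT.
have Gtrans_DOp : contains_dense_Gdelta (transitive_points f) -> DOp f.
  exact: contains_dense_Gdelta_neq0.
tfae.
- by move=> /TT_pp/TTpp_TTp.
- by move=> /TTp_TT/TT_pp.
- by move=> /TTpp_TTp/TTp_TT/TT_Gomega/Gomega_DOpp/DOpp_DOp/DOp_DO.
- by move=> /DO_TT/TT_Gomega/Gomega_DOpp/DOpp_DOp.
- by move=> /DOp_TT/TT_Gomega/Gomega_DOpp.
- move=> /DOpp_DOp/DOp_TT/TT_Gomega.
  exact: contains_dense_GdeltaS (@omega_limitT_dense_orb X f).
- by move=> /Gtrans_DOp/DOp_TT/TT_Gomega.
- by move=> /Gomega_DOpp/DOpp_DOp/DOp_TT.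
Qed.
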